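(* Set $U=\{5,6,9,10,11\}$. Then the lattice $\mathsf{A}_U(12)$ does not satisfy the lattice identity, in the variables $\mathsf x_1,\mathsf x_2,\mathsf x_3,\mathsf y_1,\mathsf y_2,\mathsf y_3$, $$\bigwedge_{1\le j\le3}(\mathsf x_1\vee\mathsf x_2\vee\mathsf x_3\vee\mathsf y_j)\le\bigvee_{1\le i\le3}(\hat{\mathsf x}_i\wedge\hat{\mathsf y}_1\wedge\hat{\mathsf y}_2\wedge\hat{\mathsf y}_3),$$ where, writing $\{i,i',i''\}=\{1,2,3\}$ for each $i\in\{1,2,3\}$, $$\hat{\mathsf x}_i=\mathsf x_{i'}\vee\mathsf x_{i''}\vee\mathsf y_1\vee\mathsf y_2\vee\mathsf y_3,\qquad\hat{\mathsf y}_i=\mathsf y_{i'}\vee\mathsf y_{i''}\vee\mathsf x_1\vee\mathsf x_2\vee\mathsf x_3 .$$ Consequently, $\mathsf{B}(3,3)$ is the homomorphic image of a sublattice of $\mathsf{A}_U(12)$.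
   Context: Notation: $[n]=\{1,\dots,n\}$ and $\mathcal{I}_n=\{(i,j)\in[n]\times[n] : i<j\}$. For a positive integer $n$ and $U\subseteq[n]$, $\mathsf{A}_U(n)$ (a Cambrian lattice of type A) is the set of all subsets $\boldsymbol{a}\subseteq\mathcal{I}_n$ that are transitive as binary relations and such that, whenever $1\le i<j<k\le n$ and $(i,k)\in\boldsymbol{a}$: $(i,j)\in\boldsymbol{a}$ if $j\in U$, and $(j,k)\in\boldsymbol{a}$ if $j\notin U$. It is ordered by inclusion and is a lattice, with meet given by intersection and join given by the transitive closure of the union. $\mathsf{B}(3,3)$ is the lattice obtained by doubling the join of $3$ atoms in the Boolean lattice with $6$ atoms: take the Boolean lattice $B$ with atoms $\boldsymbol a_1,\boldsymbol a_2,\boldsymbol a_3,\boldsymbol b_1,\boldsymbol b_2,\boldsymbol b_3$, put $\boldsymbol a=\boldsymbol a_1\vee\boldsymbol a_2\vee\boldsymbol a_3$, and let $\mathsf{B}(3,3)=B\cup\{\boldsymbol p\}$ with a new element $\boldsymbol p$, where the order extends that of $B$ and, for $x\in B$, $x<\boldsymbol p$ iff $x\le\boldsymbol a$, and $\boldsymbol p<x$ iff $\boldsymbol a<x$. A lattice satisfies an identity if it holds for every assignment of elements of the lattice to the variables. *)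

(* Defs.v *)
From HB Require Import structures.
From mathcomp Require Import all_boot all_order.

Set Implicit Arguments.
Unset Strict Implicit.
Unset Printing Implicit Defensive.

Import Order.LTheory.

(* Transitive (and not reflexive) closure of a relation given as a set of     *)
(* pairs; [connect] is the reflexive transitive closure.                      *)
Definition tclosure (T : finType) (a : {set T * T}) : {set T * T} :=
  [set p | [exists k, ((p.1, k) \in a)
                      && connect (fun x y => (x, y) \in a) k p.2]].

Lemma tclosure_base (T : finType) (a : {set T * T}) : a \subset tclosure a.
Proof.
apply/subsetP => -[i j] aij; rewrite inE; apply/existsP; exists j.
by rewrite aij connect0.
Qed.

Lemma tclosure_transitive (T : finType) (a : {set T * T}) (x y z : T) :
  (x, y) \in tclosure a -> (y, z) \in tclosure a -> (x, z) \in tclosure a.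
Proof.
rewrite !inE /= => /existsP[k /andP[xk ky]] /existsP[l /andP[yl lz]].
apply/existsP; exists k; rewrite xk; apply: connect_trans ky _.
exact: connect_trans (connect1 yl) lz.
Qed.

Lemma tclosure_ind (T : finType) (a : {set T * T}) (P : T -> T -> Prop) :
    (forall x y, (x, y) \in a -> P x y) ->
    (forall x y z, (x, y) \in a -> (y, z) \in tclosure a -> P y z -> P x z) ->
  forall x y, (x, y) \in tclosure a -> P x y.
Proof.
move=> base step x y; rewrite inE => /existsP[k /= /andP[xk /connectP[p]]].
elim: p x k xk => [|l p IH] x k xk /=; first by move=> _ ->; apply: base.
move=> /andP[kl lp] ylast; apply: (step _ k) => //; last exact: IH kl lp ylast.
rewrite inE; apply/existsP; exists l; rewrite kl /=.
by apply/connectP; exists p.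
Qed.

Lemma tclosure_min (T : finType) (a b : {set T * T}) :
    (forall x y z, (x, y) \in b -> (y, z) \in b -> (x, z) \in b) ->
  (tclosure a \subset b) = (a \subset b).
Proof.
move=> tb; apply/idP/idP => [|/subsetP ab].
  exact: subset_trans (tclosure_base a).
apply/subsetP => -[x y]; move: x y; apply: tclosure_ind => [x y /ab //|].
by move=> x y z /ab xy _; apply: tb.
Qed.

(* The ordinal [i : 'I_n] stands for the element i + 1 of [n] = {1, ..., n}.  *)
Definition cambrian_set (n : nat) (U : {set 'I_n}) (a : {set 'I_n * 'I_n}) :
    bool :=
  [&& [forall i : 'I_n, forall j : 'I_n, ((i, j) \in a) ==> (i < j)],
      [forall i : 'I_n, forall j : 'I_n, forall k : 'I_n,
         ((i, j) \in a) && ((j, k) \in a) ==> ((i, k) \in a)]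
    & [forall i : 'I_n, forall j : 'I_n, forall k : 'I_n,
         [&& i < j, j < k & (i, k) \in a] ==>
           (if j \in U then (i, j) \in a else (j, k) \in a)]].

Lemma cambrian_setP (n : nat) (U : {set 'I_n}) (a : {set 'I_n * 'I_n}) :
  reflect
    [/\ forall i j : 'I_n, (i, j) \in a -> i < j,
        forall i j k : 'I_n, (i, j) \in a -> (j, k) \in a -> (i, k) \in a
      & forall i j k : 'I_n, i < j -> j < k -> (i, k) \in a ->
          if j \in U then (i, j) \in a else (j, k) \in a]
    (cambrian_set U a).
Proof.
apply: (iffP and3P) => -[lta tra Ua]; split.
- by move=> i j; move/forallP/(_ i)/forallP/(_ j)/implyP: lta.
- move=> i j k ij jk.
  by move/forallP/(_ i)/forallP/(_ j)/forallP/(_ k): tra; rewrite ij jk.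
- move=> i j k ij jk ik.
  by move/forallP/(_ i)/forallP/(_ j)/forallP/(_ k): Ua; rewrite ij jk ik.
- by apply/forallP => i; apply/forallP => j; apply/implyP; apply: lta.
- apply/forallP => i; apply/forallP => j; apply/forallP => k.
  by apply/implyP => /andP[]; apply: tra.
- apply/forallP => i; apply/forallP => j; apply/forallP => k.
  by apply/implyP => /and3P[]; apply: Ua.
Qed.

Lemma cambrian_setI (n : nat) (U : {set 'I_n}) (a b : {set 'I_n * 'I_n}) :
  cambrian_set U a -> cambrian_set U b -> cambrian_set U (a :&: b).
Proof.
move=> /cambrian_setP[lta tra Ua] /cambrian_setP[ltb trb Ub].
apply/cambrian_setP; split=> [i j|i j k|i j k ij jk]; rewrite !inE.
- by move=> /andP[/lta].
- by move=> /andP[/tra ta /trb tb] /andP[/ta-> /tb->].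
- move=> /andP[/(Ua _ _ _ ij jk) + /(Ub _ _ _ ij jk)].
  by case: ifP => _ -> ->.
Qed.

Lemma cambrian_set_tclosureU (n : nat) (U : {set 'I_n})
    (a b : {set 'I_n * 'I_n}) :
  cambrian_set U a -> cambrian_set U b -> cambrian_set U (tclosure (a :|: b)).
Proof.
move=> /cambrian_setP[lta tra Ua] /cambrian_setP[ltb trb Ub].
set c := a :|: b.
have ltc (i j : 'I_n) : (i, j) \in c -> i < j by rewrite inE => /orP[/lta|/ltb].
have Uc (i j k : 'I_n) : i < j -> j < k -> (i, k) \in c ->
    if j \in U then (i, j) \in c else (j, k) \in c.
  move=> ij jk; rewrite !inE => /orP[/(Ua _ _ _ ij jk)|/(Ub _ _ _ ij jk)].
    by case: ifP => _ ->.
  by case: ifP => _ ->; rewrite orbT.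
have sub := subsetP (tclosure_base c).
apply/cambrian_setP; split.
- apply: tclosure_ind => // x y z /ltc xy _; exact: ltn_trans.
- exact: tclosure_transitive.
- move=> i j k ij jk ik; move: i k ik j ij jk; apply: tclosure_ind.
    move=> x y xy j xj jy; have := Uc _ _ _ xj jy xy.
    by case: ifP => _ /sub.
  move=> x y z xy yz IH j xj jz.
  case: (ltngtP j y) => [jy|yj|/val_inj ->].
  + have := Uc _ _ _ xj jy xy; case: ifP => _ /sub // jy'.
    exact: tclosure_transitive yz.
  + have := IH j yj jz; case: ifP => // _.
    exact: tclosure_transitive (sub _ xy).
  + by case: ifP => // _; apply: sub.
Qed.

(* The Cambrian lattice A_U(n).                                               *)
Record cambrian (n : nat) (U : {set 'I_n}) := Cambrian {
  cambrian_val :> {set 'I_n * 'I_n};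
  cambrian_valP : cambrian_set U cambrian_val
}.

HB.instance Definition _ n U := [isSub for @cambrian_val n U].
HB.instance Definition _ n U := [Finite of @cambrian n U by <:].

Section CambrianLattice.
Variables (n : nat) (U : {set 'I_n}).
Implicit Types a b c : cambrian U.

Definition cambrian_le a b : bool := cambrian_val a \subset cambrian_val b.

Definition cambrian_meet a b : cambrian U :=
  Cambrian (cambrian_setI (cambrian_valP a) (cambrian_valP b)).

Definition cambrian_join a b : cambrian U :=
  Cambrian (cambrian_set_tclosureU (cambrian_valP a) (cambrian_valP b)).

Fact cambrian_le_refl : reflexive cambrian_le.
Proof. by move=> a; apply: subxx. Qed.

Fact cambrian_le_anti : antisymmetric cambrian_le.
Proof. by move=> a b; rewrite /cambrian_le -eqEsubset => /eqP /val_inj. Qed.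

Fact cambrian_le_trans : transitive cambrian_le.
Proof. by move=> b a c; apply: subset_trans. Qed.

HB.instance Definition _ := Order.Le_isPOrder.Build (Order.Disp tt tt)
  (cambrian U) cambrian_le_refl cambrian_le_anti cambrian_le_trans.

Fact cambrian_meetP a b c :
  (a <= cambrian_meet b c)%O = (a <= b)%O && (a <= c)%O.
Proof. exact: subsetI. Qed.

Fact cambrian_joinP a b c :
  (cambrian_join a b <= c)%O = (a <= c)%O && (b <= c)%O.
Proof.
have [_ trc _] := cambrian_setP _ _ (cambrian_valP c).
by rewrite /Order.le /= /cambrian_le tclosure_min // subUset.
Qed.

HB.instance Definition _ := Order.POrder_MeetJoin_isLattice.Build
  (Order.Disp tt tt) (cambrian U) cambrian_meetP cambrian_joinP.

End CambrianLattice.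

(* The lattice B(m, n): the Boolean lattice is the powerset of 'I_m + 'I_n,   *)
(* with atoms a_i = {inl i} and b_j = {inr j}; [doubled_elt] is the join of   *)
(* the a_i, and [None] is the new element p.                                  *)
Definition doubled (m n : nat) : Type := option {set 'I_m + 'I_n}.

HB.instance Definition _ m n := Finite.on (doubled m n).

Section DoubledLattice.
Variables m n : nat.
Implicit Types x y z : doubled m n.

Definition doubled_elt : {set 'I_m + 'I_n} := [set inl i | i : 'I_m].

Local Notation a := doubled_elt.

Definition doubled_le x y : bool :=
  match x, y with
  | Some u, Some v => u \subset v
  | Some u, None   => u \subset a
  | None,   Some v => a \proper v
  | None,   None   => true
  end.

Definition doubled_meet x y : doubled m n :=
  match x, y with
  | Some u, Some v =>
      if [&& a \proper u, a \proper v & u :&: v == a] then None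
      else Some (u :&: v)
  | Some u, None | None, Some u =>
      if a \proper u then None else Some (u :&: a)
  | None, None => None
  end.

Definition doubled_join x y : doubled m n :=
  match x, y with
  | Some u, Some v => Some (u :|: v)
  | Some u, None | None, Some u =>
      if u \subset a then None else Some (u :|: a)
  | None, None => None
  end.

Fact doubled_le_refl : reflexive doubled_le.
Proof. by case=> //= u; apply: subxx. Qed.

Fact doubled_le_anti : antisymmetric doubled_le.
Proof.
case=> [u|] [v|] //=; first by rewrite -eqEsubset => /eqP ->.
  by move=> /andP[ua /proper_sub_trans /(_ ua)]; rewrite properxx.
by move=> /andP[au /(proper_sub_trans au)]; rewrite properxx.
Qed.

Fact doubled_le_trans : transitive doubled_le.
Proof.
case=> [v|] [u|] [w|] //=.
- exact: subset_trans.
- exact: subset_trans.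
- exact: proper_sub_trans.
- by move=> ua /proper_sub; apply: subset_trans.
Qed.

HB.instance Definition _ := Order.Le_isPOrder.Build (Order.Disp tt tt)
  (doubled m n) doubled_le_refl doubled_le_anti doubled_le_trans.

Fact doubled_meetP x y z :
  (x <= doubled_meet y z)%O = (x <= y)%O && (x <= z)%O.
Proof.
have key (u v : {set 'I_m + 'I_n}) :
    (a \subset u :&: v) = (u :&: v == a) || (a \proper u :&: v).
  by rewrite [_ == _]eq_sym -subEproper.
case: x y z => [u|] [v|] [w|]; rewrite /Order.le /=.
- case: ifP => [/and3P[_ _ /eqP <-]|_] /=; exact: subsetI.
- case: ifP => av /=; last exact: subsetI.
  case: (boolP (u \subset a)) => ua; rewrite ?andbF ?andbT //.
  by rewrite (subset_trans ua (proper_sub av)).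
- case: ifP => av /=; last by rewrite subsetI andbC.
  case: (boolP (u \subset a)) => //= ua.
  by rewrite (subset_trans ua (proper_sub av)).
- by rewrite andbb.
- case: ifP => [/and3P[-> -> _] //|]; rewrite /=.
  case: (boolP (a \proper v)) => [av|nav]; last first.
    by move=> _; apply/negP => h; case/negP: nav;
    exact: proper_sub_trans h (subsetIl _ _).
  case: (boolP (a \proper w)) => [aw|naw]; last first.
    by move=> _; apply/negP => h; case/negP: naw;
    exact: proper_sub_trans h (subsetIr _ _).
  move=> /= ne; have := key v w; rewrite ne /= => <-.
  by rewrite subsetI !proper_sub.
- case: ifP => av /=; rewrite ?andbT ?av //.
  apply/negP => h; have := proper_sub_trans h (subsetIr _ _).
  by rewrite properxx.
- case: ifP => av /=; rewrite ?av //.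
  apply/negP => h; have := proper_sub_trans h (subsetIr _ _).
  by rewrite properxx.
- by [].
Qed.

Fact doubled_joinP x y z :
  (doubled_join x y <= z)%O = (x <= z)%O && (y <= z)%O.
Proof.
have key (u w : {set 'I_m + 'I_n}) : ~~ (u \subset a) ->
    (u :|: a \subset w) = (u \subset w) && (a \proper w).
  move=> ua; rewrite subUset; case: (boolP (u \subset w)) => //= uw.
  apply/idP/idP => [aw|/proper_sub //]; rewrite properE aw /=.
  by apply: contra ua; apply: subset_trans.
have low (u w : {set 'I_m + 'I_n}) : u \subset a ->
    (a \proper w) = (u \subset w) && (a \proper w).
  move=> ua; case: (boolP (a \proper w)) => [aw|]; rewrite ?andbF //.
  by rewrite (subset_trans ua (proper_sub aw)).
case: x y z => [u|] [v|] [w|]; rewrite /Order.le /=.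
- exact: subUset.
- exact: subUset.
- by case: ifPn => ua /=; [apply: low | apply: key].
- by case: ifPn => ua //=; rewrite subUset (negbTE ua).
- by rewrite andbC; case: ifPn => ua /=; [apply: low | apply: key].
- by case: ifPn => ua //=; rewrite subUset (negbTE ua).
- by rewrite andbb.
- by [].
Qed.

HB.instance Definition _ := Order.POrder_MeetJoin_isLattice.Build
  (Order.Disp tt tt) (doubled m n) doubled_meetP doubled_joinP.

End DoubledLattice.

Definition satisfies_identity (d : Order.disp_t) (L : latticeType d) : Prop :=
  forall x1 x2 x3 y1 y2 y3 : L,
    let xh1 := (x2 `|` x3 `|` y1 `|` y2 `|` y3)%O in
    let xh2 := (x1 `|` x3 `|` y1 `|` y2 `|` y3)%O in
    let xh3 := (x1 `|` x2 `|` y1 `|` y2 `|` y3)%O in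
    let yh1 := (y2 `|` y3 `|` x1 `|` x2 `|` x3)%O in
    let yh2 := (y1 `|` y3 `|` x1 `|` x2 `|` x3)%O in
    let yh3 := (y1 `|` y2 `|` x1 `|` x2 `|` x3)%O in
    ((x1 `|` x2 `|` x3 `|` y1) `&` (x1 `|` x2 `|` x3 `|` y2)
       `&` (x1 `|` x2 `|` x3 `|` y3)
     <= (xh1 `&` yh1 `&` yh2 `&` yh3) `|` (xh2 `&` yh1 `&` yh2 `&` yh3)
       `|` (xh3 `&` yh1 `&` yh2 `&` yh3))%O.

(* [M] is a homomorphic image of the sublattice of [L] with underlying set    *)
(* [S]; only the values of [f] on [S] matter.                                 *)
Definition hom_image_of_sublattice (d d' : Order.disp_t)
    (M : latticeType d') (L : latticeType d) : Prop :=
  exists (S : {pred L}) (f : L -> M),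
    [/\ meet_closed S /\ join_closed S,
        {in S &, {morph f : x y / (x `&` y)%O}},
        {in S &, {morph f : x y / (x `|` y)%O}}
      & forall z : M, exists2 x, x \in S & f x = z].

(* Main.v *)
Require Import Defs.
From HB Require Import structures.
From mathcomp Require Import all_boot all_order.

(* The identity fails at the pair (1, 12).  There are three chains            *)
(*   1 -y1- 2 -x2- 3 -x1- 4 -x3- 8 -x2- 12,                                   *)
(*   1 -x2- 5 -x1- 6 -y2- 7 -x3- 8 -x2- 12,                                   *)
(*   1 -x2- 5 -x1- 9 -x3- 10 -x2- 11 -y3- 12;                                 *)
(* let each variable be generated by the steps that carry its name, so that   *)
(* (1, 12) lies in the left-hand side.  The pairs that do not go from U + {1} *)
(* to its complement form a member of A_U(12), which contains the right-hand  *)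
(* side but not (1, 12).  The chains were found by a computer search; the     *)
(* configuration is invariant under i |-> 13 - i combined with the exchange   *)
(* of the indices 1 and 3.                                                    *)
(*   In any lattice, suppose that the left-hand side P of the identity is not *)
(* below its right-hand side Q for some values of the variables.  Consider    *)
(* the elements z such that each variable t satisfies t <= z or z <= t^, and  *)
(* such that P <= z or z <= Q when exactly the x_i are below z.  They form a  *)
(* sublattice, and the map to B(3,3) sends z to the set of variables below z, *)
(* or to p if this set is {x_1, x_2, x_3} and P <= z.                         *)

Set Implicit Arguments.
Unset Strict Implicit.
Unset Printing Implicit Defensive.

Import Order.LTheory.

(** The generators [g t] and bounds [h t] abstract the variables and their hats. As P is not below
    Q, no [g t] is below [h t], so each z in the sublattice satisfies exactly one of [g t <= z] and
    [z <= h t]. Hence [g t] is join-prime in the sublattice, and P against Q decides in the same way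
    between p and {x_1, x_2, x_3}. This gives [doubled_hom_image], and
    [hom_image_of_identity_failure] reduces the theorem to one failing assignment. For that,
    [cambrian12_identity_failure] computes no join: transitivity along the chains bounds the
    left-hand side from below, and explicit members of A_U(12) bound the right-hand side from
    above. *)

Section DoubledImage.
Variables (d : Order.disp_t) (L : latticeType d) (m n : nat).
Variables (g h : 'I_m + 'I_n -> L) (P Q : L).

Local Notation A := (doubled_elt m n).

Hypotheses (m_gt1 : 1 < m) (n_gt1 : 1 < n).
Hypothesis gh : forall s t, s != t -> (g s <= h t)%O.
Hypothesis PQ : ~~ (P <= Q)%O.
Hypothesis gP : forall i, (g (inl i) <= P)%O.
(** P lies below each join of all x_i with one y_j; upper bounds express this because [L] may lack a
    bottom for an indexed join. [le_Q] is the dual condition on Q. *)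
Hypothesis P_le : forall j z,
  (forall i, (g (inl i) <= z)%O) -> (g (inr j) <= z)%O -> (P <= z)%O.
Hypothesis le_Q : forall i z,
  (z <= h (inl i))%O -> (forall j, (z <= h (inr j))%O) -> (z <= Q)%O.

(** * The sublattice and its projection onto B(m,n) *)

Let atoms_below (z : L) : {set 'I_m + 'I_n} := [set t | (g t <= z)%O].
Local Notation D := atoms_below.

Let subl : {pred L} := fun z =>
  [forall t, (g t <= z)%O || (z <= h t)%O]
  && ((D z == A) ==> (P <= z)%O || (z <= Q)%O).

Let proj (z : L) : doubled m n :=
  if (D z == A) && (P <= z)%O then None else Some (D z).

Let in_A t : (t \in A) = if t is inl _ then true else false.
Proof.
apply/imsetP/idP => [[i _ ->] //|]; case: t => // i _.
by exists i.
Qed.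

Let other k (i : 'I_k) : 1 < k -> exists j : 'I_k, j != i.
Proof.
case: k i => [|[|k]] // i _; case: (eqVneq i ord0) => [->|ni].
  by exists ord_max.
by exists ord0; rewrite eq_sym.
Qed.

Let P_le_h j : (P <= h (inr j))%O.
Proof.
have [k kj] := other j n_gt1.
by apply: (P_le (j := k)) => [i|]; apply: gh.
Qed.

Let gQ i : (g (inl i) <= Q)%O.
Proof.
have [k ki] := other i m_gt1.
by apply: (le_Q (i := k)) => [|j]; apply: gh => //; rewrite eq_sym.
Qed.

(** Otherwise [P <= Q]: for t = x_i, P falls below [h t] as well as below the hat of every y; for t
    = y_j, [g t] falls below Q along with every x_i. *)
Let ghN t : ~~ (g t <= h t)%O.
Proof.
apply: contra PQ; case: t => [i|j] ght.
- apply: (le_Q (i := i)) => [|j]; last exact: P_le_h.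
  apply: (P_le (j := Ordinal (ltnW n_gt1))); last exact: gh.
  by move=> k; case: (eqVneq k i) => [->|ki] //; apply: gh.
- apply: (P_le (j := j)) => //; apply: (le_Q (i := Ordinal (ltnW m_gt1))).
    exact: gh.
  by move=> k; case: (eqVneq k j) => [->|kj] //; apply: gh; rewrite eq_sym.
Qed.

Let sublP z : reflect
  ((forall t, (g t <= z)%O \/ (z <= h t)%O)
    /\ (D z = A -> (P <= z)%O \/ (z <= Q)%O)) (z \in subl).
Proof.
apply: (iffP andP) => -[dz cz]; split.
- by move=> t; apply/orP; move/forallP: dz.
- by move=> /eqP Dz; apply/orP; move: cz; rewrite Dz.
- by apply/forallP => t; apply/orP.
- by apply/implyP => /eqP Dz; apply/orP; apply: cz.
Qed.

Let DI x y : D (x `&` y)%O = D x :&: D y.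
Proof. by apply/setP => t; rewrite !inE lexI. Qed.

Let DU x y : x \in subl -> y \in subl -> D (x `|` y)%O = D x :|: D y.
Proof.
move=> /sublP[dx _] /sublP[dy _]; apply/setP => t; rewrite !inE.
apply/idP/orP => [gxy|]; last by case=> gt; apply: lexU2; rewrite gt ?orbT.
have [|xh] := dx t; first by left.
have [|yh] := dy t; first by right.
by case/negP: (ghN t); apply: le_trans gxy _; rewrite leUx xh.
Qed.

Let A_proper z : A \proper D z -> (P <= z)%O.
Proof.
case/properP => /subsetP sA [[i|j]]; rewrite !inE => gz; rewrite in_A // => _.
by apply: P_le gz => i; have := sA (inl i); rewrite in_A inE; apply.
Qed.

Let A_sub z : (P <= z)%O -> A \subset D z.
Proof.
move=> Pz; apply/subsetP => -[i|j]; rewrite in_A ?inE // => _.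
exact: le_trans (gP i) Pz.
Qed.

(** If [D z = A], the second condition of [subl] decides. Otherwise z misses some x_i and every y_j,
    hence lies below hats whose common lower bounds are below Q. *)
Let sub_A z : z \in subl -> D z \subset A -> ~~ (P <= z)%O -> (z <= Q)%O.
Proof.
move=> /sublP[dz cz] sDA nPz; case: (eqVneq (D z) A) => [DA|DnA].
  by case: (cz DA) => // Pz; rewrite Pz in nPz.
have := DnA; rewrite eqEsubset sDA /= => /subsetPn[[i|j]]; rewrite in_A // => _.
rewrite inE => ngz; apply: (le_Q (i := i)) => [|j].
  by case: (dz (inl i)) => // gz; rewrite gz in ngz.
case: (dz (inr j)) => // gz; have /subsetP/(_ (inr j)) := sDA.
by rewrite inE in_A gz => /(_ isT).
Qed.

(** If neither x nor y is above P, then [sub_A] puts both below Q, so their join cannot be above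
    P. *)
Let P_leU x y : x \in subl -> y \in subl -> D x :|: D y = A ->
  (P <= x `|` y)%O = (P <= x)%O || (P <= y)%O.
Proof.
move=> Sx Sy DA; apply/idP/idP => [|/orP[]Pz]; last 2 first.
- by rewrite lexU2 // Pz.
- by rewrite lexU2 // Pz orbT.
apply: contraLR; rewrite negb_or => /andP[nPx nPy]; apply: contra PQ => Pxy.
by apply: le_trans Pxy _; rewrite leUx !sub_A // -DA ?subsetUl ?subsetUr.
Qed.

Let subl_meet : meet_closed subl.
Proof.
move=> x y /sublP[dx cx] /sublP[dy cy]; apply/sublP; split=> [t|].
  case: (dx t) => gx; last by right; rewrite leIx2 // gx.
  case: (dy t) => gy; last by right; rewrite leIx2 // gy orbT.
  by left; rewrite lexI gx.
rewrite DI => DA; rewrite lexI.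
have up z : A \subset D z -> (D z = A -> (P <= z)%O \/ (z <= Q)%O) ->
    (P <= z)%O \/ (z <= Q)%O.
  by rewrite subEproper => /orP[/eqP <-|/A_proper]; [apply|left].
have [|Px|xQ] := up x _ cx; first by rewrite -DA subsetIl.
  have [|Py|yQ] := up y _ cy; first by rewrite -DA subsetIr.
    by left; rewrite Px.
  by right; rewrite leIx2 // yQ orbT.
by right; rewrite leIx2 // xQ.
Qed.

Let subl_join : join_closed subl.
Proof.
move=> x y Sx Sy; have [dx _] := sublP _ Sx; have [dy _] := sublP _ Sy.
apply/sublP; split=> [t|].
  case: (dx t) => gx; first by left; rewrite lexU2 // gx.
  case: (dy t) => gy; first by left; rewrite lexU2 // gy orbT.
  by right; rewrite leUx gx.
rewrite DU // => DA; rewrite P_leU // leUx.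
case: (boolP (P <= x)%O) => nPx; first by left.
case: (boolP (P <= y)%O) => nPy; first by left.
by right; rewrite !sub_A // -DA ?subsetUl ?subsetUr.
Qed.

Let proj_meet x y : proj (x `&` y)%O = (proj x `&` proj y)%O.
Proof.
rewrite /proj DI lexI [RHS]/Order.meet /=.
(* Every x_i is below P, so an element above P that is not sent to p has strictly more than [A]
   below it. *)
have AN u z : D z = u -> ~~ ((u == A) && (P <= z)%O) -> (P <= z)%O ->
    A \proper u.
  move=> <- + Pz; rewrite Pz andbT => DnA.
  by rewrite properEneq eq_sym DnA A_sub.
case: (boolP ((D x == A) && _)) => [/andP[/eqP-> Px]|nx];
  case: (boolP ((D y == A) && _)) => [/andP[/eqP-> Py]|ny] /=.
- by rewrite setIid eqxx Px Py.
- rewrite Px [A :&: _]setIC; case: (boolP (A \proper D y)) => Ay.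
    have -> : D y :&: A = A by apply/setIidPr/proper_sub.
    by rewrite eqxx A_proper.
  by case: ifP => // /andP[_ /(AN _ _ erefl ny)]; rewrite (negPf Ay).
- rewrite Py andbT; case: (boolP (A \proper D x)) => Ax.
    have -> : D x :&: A = A by apply/setIidPr/proper_sub.
    by rewrite eqxx A_proper.
  by case: ifP => // /andP[_ /(AN _ _ erefl nx)]; rewrite (negPf Ax).
- case: ifP => [/and3P[DA Px Py]|DP].
    by rewrite (AN _ _ erefl nx) // (AN _ _ erefl ny) // DA.
  case: ifP => // /and3P[/A_proper Px /A_proper Py DA].
  by rewrite Px Py DA in DP.
Qed.

Let proj_join : {in subl &, {morph proj : x y / (x `|` y)%O}}.
Proof.
move=> x y Sx Sy; rewrite /proj DU // [RHS]/Order.join /=.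
have PU : (D x :|: D y == A) && (P <= x `|` y)%O
    = (D x :|: D y == A) && ((P <= x)%O || (P <= y)%O).
  by case: eqP => //= DA; rewrite P_leU.
rewrite PU {PU}.
case: (boolP ((D x == A) && _)) => [/andP[/eqP-> Px]|nx];
  case: (boolP ((D y == A) && _)) => [/andP[/eqP-> Py]|ny] /=.
- by rewrite setUid eqxx Px.
- rewrite Px andbT [A :|: _]setUC; case: ifP => [/eqP <-|].
    by rewrite subsetUl.
  by case: ifP => // /setUidPr ->; rewrite eqxx.
- rewrite Py orbT andbT; case: ifP => [/eqP <-|].
    by rewrite subsetUl.
  by case: ifP => // /setUidPr ->; rewrite eqxx.
- case: ifP => // /andP[/eqP DA /orP[]Pz].
    by move: nx; rewrite Pz eqEsubset A_sub // -{1}DA subsetUl.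
  by move: ny; rewrite Pz eqEsubset A_sub // -{1}DA subsetUr.
Qed.

Let proj_g t : g t \in subl /\ proj (g t) = Some [set t].
Proof.
have Dt : D (g t) = [set t].
  apply/setP => s; rewrite !inE; case: (eqVneq s t) => [->|st].
    exact: lexx.
  by apply/negP => gst; case/negP: (ghN s); apply: le_trans gst (gh _);
    rewrite eq_sym.
have DnA : [set t] != A.
  have [i it] : exists i, inl i != t.
    case: t {Dt} => [k|j]; last by exists (Ordinal (ltnW m_gt1)).
    by have [i] := other k m_gt1; exists i.
  by apply/eqP => /setP/(_ (inl i)); rewrite in_A inE (negPf it).
split; last by rewrite /proj Dt (negPf DnA).
apply/sublP; split=> [s|]; last by rewrite Dt => /eqP; rewrite (negPf DnA).
by case: (eqVneq s t) => [->|st]; [left|right; apply: gh; rewrite eq_sym].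
Qed.

Lemma doubled_hom_image : hom_image_of_sublattice (doubled m n) L.
Proof.
exists subl, proj; split; [by split| |exact: proj_join|].
  by move=> x y _ _; apply: proj_meet.
case=> [u|].
  suff [x Sx fx] : exists2 x, x \in subl & proj x = Some [set t in enum u].
    by exists x => //; rewrite fx set_enum.
  (* Sets are built by joining singletons, the images of the generators, to the empty set, the image
     of the meet of one x and one y. *)
  elim: (enum u) => [|t s [x Sx fx]].
    pose i0 : 'I_m := Ordinal (ltnW m_gt1).
    pose j0 : 'I_n := Ordinal (ltnW n_gt1).
    have [Si fi] := proj_g (inl i0); have [Sj fj] := proj_g (inr j0).
    exists (g (inl i0) `&` g (inr j0))%O; first exact: subl_meet.
    rewrite proj_meet fi fj /Order.meet /=.
    have -> : [set inl i0] :&: [set inr j0]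
        = [set t in [::]] :> {set 'I_m + 'I_n}.
      by apply/setP => -[i|j]; rewrite !inE ?andbF.
    case: ifP => // /and3P[_ /proper_sub/subsetP/(_ (inl i0))].
    by rewrite in_A inE => /(_ isT).
  have [St ft] := proj_g t.
  exists (g t `|` x)%O; first exact: subl_join.
  by rewrite proj_join // ft fx set_cons.
(* The new element p is the image of P, which has every x_i and no y_j below it. *)
exists P.
  by apply/sublP; split=> [[i|j]|]; by [left; apply: gP|right|left].
have DP : D P = A.
  apply/eqP; rewrite eqEsubset A_sub // andbT.
  apply/subsetP => -[i|j]; rewrite in_A // inE => gjP.
  by case/negP: (ghN (inr j)); apply: le_trans gjP (P_le_h j).
by rewrite /proj lexx DP eqxx.
Qed.

End DoubledImage.

(** * Lattices in which the identity fails *)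

Section IdentityFailure.
Variables (d : Order.disp_t) (L : latticeType d).
Implicit Types x y z : L.

Let le_joinl x y z : (x <= y)%O -> (x <= y `|` z)%O.
Proof. by move=> xy; rewrite lexU2 ?xy. Qed.

Let le_joinr x y z : (x <= z)%O -> (x <= y `|` z)%O.
Proof. by move=> xz; rewrite lexU2 ?xz ?orbT. Qed.

Let join_le x y z : (x <= z)%O -> (y <= z)%O -> (x `|` y <= z)%O.
Proof. by move=> xz yz; rewrite leUx xz. Qed.

Let le_meet x y z : (x <= y)%O -> (x <= z)%O -> (x <= y `&` z)%O.
Proof. by move=> xy xz; rewrite lexI xy. Qed.

Let meet_lel x y z : (x <= z)%O -> (x `&` y <= z)%O.
Proof. by move=> xz; rewrite leIx2 ?xz. Qed.

Let meet_ler x y z : (y <= z)%O -> (x `&` y <= z)%O.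
Proof. by move=> yz; rewrite leIx2 ?yz ?orbT. Qed.

(** Whitman's procedure for inequalities between lattice terms, with hypotheses as base cases. *)
Ltac lattice := lazymatch goal with
  | |- is_true (_ `|` _ <= _)%O => apply: join_le; lattice
  | |- is_true (_ <= _ `&` _)%O => apply: le_meet; lattice
  | |- is_true (?x <= ?x)%O => exact: lexx
  | |- is_true (_ `&` _ <= _)%O => solve [apply: meet_lel; lattice
      | apply: meet_ler; lattice | apply: le_joinl; lattice
      | apply: le_joinr; lattice]
  | |- is_true (_ <= _ `|` _)%O =>
      solve [apply: le_joinl; lattice | apply: le_joinr; lattice]
  | |- _ => assumption
  end.

Definition identity_lhs (x1 x2 x3 y1 y2 y3 : L) : L :=
  ((x1 `|` x2 `|` x3 `|` y1) `&` (x1 `|` x2 `|` x3 `|` y2)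
     `&` (x1 `|` x2 `|` x3 `|` y3))%O.

Definition identity_rhs (x1 x2 x3 y1 y2 y3 : L) : L :=
  let xh1 := (x2 `|` x3 `|` y1 `|` y2 `|` y3)%O in
  let xh2 := (x1 `|` x3 `|` y1 `|` y2 `|` y3)%O in
  let xh3 := (x1 `|` x2 `|` y1 `|` y2 `|` y3)%O in
  let yh1 := (y2 `|` y3 `|` x1 `|` x2 `|` x3)%O in
  let yh2 := (y1 `|` y3 `|` x1 `|` x2 `|` x3)%O in
  let yh3 := (y1 `|` y2 `|` x1 `|` x2 `|` x3)%O in
  ((xh1 `&` yh1 `&` yh2 `&` yh3) `|` (xh2 `&` yh1 `&` yh2 `&` yh3)
     `|` (xh3 `&` yh1 `&` yh2 `&` yh3))%O.

(** With the hats as [h], the conditions of [doubled_hom_image] on P and Q other than [PQ] hold in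
    every lattice. *)
Lemma hom_image_of_identity_failure (x1 x2 x3 y1 y2 y3 : L) :
  ~~ (identity_lhs x1 x2 x3 y1 y2 y3 <= identity_rhs x1 x2 x3 y1 y2 y3)%O ->
  hom_image_of_sublattice (doubled 3 3) L.
Proof.
rewrite /identity_rhs.
set xh1 := (x2 `|` x3 `|` y1 `|` y2 `|` y3)%O.
set xh2 := (x1 `|` x3 `|` y1 `|` y2 `|` y3)%O.
set xh3 := (x1 `|` x2 `|` y1 `|` y2 `|` y3)%O.
set yh1 := (y2 `|` y3 `|` x1 `|` x2 `|` x3)%O.
set yh2 := (y1 `|` y3 `|` x1 `|` x2 `|` x3)%O.
set yh3 := (y1 `|` y2 `|` x1 `|` x2 `|` x3)%O.
set P := identity_lhs _ _ _ _ _ _; set Q := (Q in (_ <= Q)%O) => PQ.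
pose X := (x1 `|` x2 `|` x3)%O.
(* Indices are below 3, so the defaults of [nth] are never returned. *)
pose g (t : 'I_3 + 'I_3) : L := match t with
  | inl i => nth x1 [:: x1; x2; x3] i | inr j => nth y1 [:: y1; y2; y3] j end.
pose h (t : 'I_3 + 'I_3) : L := match t with
  | inl i => nth xh1 [:: xh1; xh2; xh3] i
  | inr j => nth yh1 [:: yh1; yh2; yh3] j end.
apply: (@doubled_hom_image _ L 3 3 g h P Q) => //.
- move=> [[[|[|[|]]] // ?]|[[|[|[|]]] // ?]];
    move=> [[[|[|[|]]] // ?]|[[|[|[|]]] // ?]];
    by rewrite ?eqxx // => _ /=;
    rewrite ?/xh1 ?/xh2 ?/xh3 ?/yh1 ?/yh2 ?/yh3; lattice.
- by move=> [[|[|[|]]] // ?] /=; rewrite /P /identity_lhs; lattice.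
- move=> [[|[|[|]]] // lt_j] z xz /= yz;
    have := (xz (inord 0), xz (inord 1), xz (inord 2));
    rewrite /g /h !inordK //= => -[[x1z x2z] x3z].
  + by apply: (@le_trans _ _ (X `|` y1)%O);
      rewrite /X ?/P ?/identity_lhs; lattice.
  + by apply: (@le_trans _ _ (X `|` y2)%O);
      rewrite /X ?/P ?/identity_lhs; lattice.
  + by apply: (@le_trans _ _ (X `|` y3)%O);
      rewrite /X ?/P ?/identity_lhs; lattice.
- move=> [[|[|[|]]] // lt_i] z /= zx zy;
    have := (zy (inord 0), zy (inord 1), zy (inord 2));
    rewrite /g /h !inordK //= => -[[zy1 zy2] zy3].
  + by apply: (@le_trans _ _ (xh1 `&` yh1 `&` yh2 `&` yh3)%O);
      rewrite ?/Q; lattice.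
  + by apply: (@le_trans _ _ (xh2 `&` yh1 `&` yh2 `&` yh3)%O);
      rewrite ?/Q; lattice.
  + by apply: (@le_trans _ _ (xh3 `&` yh1 `&` yh2 `&` yh3)%O);
      rewrite ?/Q; lattice.
Qed.

End IdentityFailure.

(** * Members of A_U(n) as computable tables *)

Section Tables.
Variables (n : nat) (u : seq nat).
Implicit Types s t : seq (nat * nat).

Definition table_pairs : seq (nat * nat) :=
  [seq p : nat * nat <- [seq (i, j) | i <- iota 1 n, j <- iota 1 n]
    | p.1 < p.2].

(* The smallest member of A_U(n) containing p.                                *)
Definition irreducible_table (p : nat * nat) : seq (nat * nat) :=
  [seq q : nat * nat <- table_pairs | [&& p.1 <= q.1, q.2 <= p.2,
     (q.1 == p.1) || (q.1 \notin u) & (q.2 == p.2) || (q.2 \in u)]].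

(** Each round doubles the length of the paths covered, so [n] rounds suffice for increasing paths
    in [n]. The tables obtained are certified afterwards by [cambrian_table]. *)
Definition closure_table s : seq (nat * nat) :=
  iter n (fun s => undup (s ++
    flatten [seq [seq (p.1, q.2) | q : nat * nat <- s & q.1 == p.2]
            | p : nat * nat <- s])) s.

Definition generated_table s : seq (nat * nat) :=
  closure_table (flatten [seq irreducible_table p | p <- s]).

Definition cambrian_table s : bool :=
  [&& all (fun p : nat * nat => p.1 < p.2) s,
      all (fun p : nat * nat =>
        all (fun q : nat * nat => (p.2 == q.1) ==> ((p.1, q.2) \in s)) s) s
    & all (fun p : nat * nat => all (fun j => (p.1 < j) && (j < p.2) ==>
        (if j \in u then (p.1, j) \in s else (j, p.2) \in s)) (iota 1 n)) s].

(* Tables are 1-based, ordinals 0-based.                                      *)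
Definition table_set s : {set 'I_n * 'I_n} :=
  [set p : 'I_n * 'I_n | (p.1.+1, p.2.+1) \in s].

Local Notation U := [set i : 'I_n | i.+1 \in u].

Lemma cambrian_table_set s : cambrian_table s -> cambrian_set U (table_set s).
Proof.
case/and3P => /allP lts /allP trs /allP Us; apply/cambrian_setP; split.
- by move=> i j; rewrite inE => /lts.
- move=> i j k; rewrite !inE => ij jk.
  by move/allP/(_ _ jk): (trs _ ij); rewrite eqxx.
- move=> i j k ij jk; rewrite !inE => ik.
  have jn : j.+1 \in iota 1 n by rewrite mem_iota /= add1n ltnS.
  by move/allP/(_ _ jn): (Us _ ik); rewrite /= !ltnS ij jk.
Qed.

Definition table_elt s (cs : cambrian_table s) : cambrian U :=
  Cambrian (cambrian_table_set cs).

Lemma table_elt_le s t (cs : cambrian_table s) (ct : cambrian_table t) :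
  all (mem t) s -> (table_elt cs <= table_elt ct)%O.
Proof.
by move=> /allP st; apply/subsetP => p; rewrite !inE; apply: st.
Qed.

Lemma mem_cambrian_meet (a b : cambrian U) p :
  (p \in cambrian_val (a `&` b)%O)
  = (p \in cambrian_val a) && (p \in cambrian_val b).
Proof. exact: in_setI. Qed.

(** Places a pair in a join without computing a closure, since members of A_U(n) are transitive. *)
Lemma path_mem_cambrian s (z : cambrian U) (i j : 'I_n) (p : seq 'I_n) :
  table_set s \subset cambrian_val z ->
  path (fun k l : 'I_n => (k.+1, l.+1) \in s) i (rcons p j) ->
  (i, j) \in cambrian_val z.
Proof.
move=> /subsetP sz; have [_ trz _] := cambrian_setP _ _ (cambrian_valP z).
have step (k l : 'I_n) : (k.+1, l.+1) \in s -> (k, l) \in cambrian_val z.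
  by move=> kl; apply: sz; rewrite inE.
elim: p i => [|k p IH] i /= /andP[/step ik]; first by [].
by move/IH; apply: trz.
Qed.

End Tables.

(** * The failing assignment in A_U(12) *)

Local Notation u12 := [:: 5; 6; 9; 10; 11].
Local Notation U12 := [set i : 'I_12 | i.+1 \in u12].
Local Notation gen := (generated_table 12 u12).
Local Notation cl := (closure_table 12).
Local Notation pt k := (@Ordinal 12 k.-1 isT).

(* Stored in normal form, since unification would unfold the closures.        *)
Definition table_x1 := Eval vm_compute in gen [:: (3, 4); (5, 6); (5, 9)].
Definition table_x2 := Eval vm_compute in
  gen [:: (2, 3); (8, 12); (1, 5); (10, 11)].
Definition table_x3 := Eval vm_compute in gen [:: (4, 8); (7, 8); (9, 10)].
Definition table_y1 := Eval vm_compute in gen [:: (1, 2)].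
Definition table_y2 := Eval vm_compute in gen [:: (6, 7)].
Definition table_y3 := Eval vm_compute in gen [:: (11, 12)].
Definition table_xh1 := Eval vm_compute in
  cl (table_x2 ++ table_x3 ++ table_y1 ++ table_y2 ++ table_y3).
Definition table_xh2 := Eval vm_compute in
  cl (table_x1 ++ table_x3 ++ table_y1 ++ table_y2 ++ table_y3).
Definition table_xh3 := Eval vm_compute in
  cl (table_x1 ++ table_x2 ++ table_y1 ++ table_y2 ++ table_y3).
Definition table_yh1 := Eval vm_compute in
  cl (table_y2 ++ table_y3 ++ table_x1 ++ table_x2 ++ table_x3).
Definition table_yh2 := Eval vm_compute in
  cl (table_y1 ++ table_y3 ++ table_x1 ++ table_x2 ++ table_x3).
Definition table_yh3 := Eval vm_compute in
  cl (table_y1 ++ table_y2 ++ table_x1 ++ table_x2 ++ table_x3).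
Definition table_cut := Eval vm_compute in
  [seq p : nat * nat <- table_pairs 12 |
   ~~ ((p.1 \in 1 :: u12) && (p.2 \notin u12))].

Lemma cambrian12_identity_failure :
  exists x1 x2 x3 y1 y2 y3 : cambrian U12,
  ~~ (identity_lhs x1 x2 x3 y1 y2 y3 <= identity_rhs x1 x2 x3 y1 y2 y3)%O.
Proof.
have cx1 : cambrian_table 12 u12 table_x1 by vm_compute.
have cx2 : cambrian_table 12 u12 table_x2 by vm_compute.
have cx3 : cambrian_table 12 u12 table_x3 by vm_compute.
have cy1 : cambrian_table 12 u12 table_y1 by vm_compute.
have cy2 : cambrian_table 12 u12 table_y2 by vm_compute.
have cy3 : cambrian_table 12 u12 table_y3 by vm_compute.
have cxh1 : cambrian_table 12 u12 table_xh1 by vm_compute.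
have cxh2 : cambrian_table 12 u12 table_xh2 by vm_compute.
have cxh3 : cambrian_table 12 u12 table_xh3 by vm_compute.
have cyh1 : cambrian_table 12 u12 table_yh1 by vm_compute.
have cyh2 : cambrian_table 12 u12 table_yh2 by vm_compute.
have cyh3 : cambrian_table 12 u12 table_yh3 by vm_compute.
have ccut : cambrian_table 12 u12 table_cut by vm_compute.
exists (table_elt cx1), (table_elt cx2), (table_elt cx3).
exists (table_elt cy1), (table_elt cy2), (table_elt cy3).
rewrite /identity_lhs /identity_rhs; set x1 := table_elt cx1.
set x2 := table_elt cx2; set x3 := table_elt cx3.
set y1 := table_elt cy1; set y2 := table_elt cy2; set y3 := table_elt cy3.
have in_join (ty : seq (nat * nat)) (cy : cambrian_table 12 u12 ty) p :
    path (fun k l : 'I_12 =>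
        (k.+1, l.+1) \in table_x1 ++ table_x2 ++ table_x3 ++ ty)
      (pt 1) (rcons p (pt 12)) ->
    (pt 1, pt 12) \in cambrian_val (x1 `|` x2 `|` x3 `|` table_elt cy)%O.
  apply: path_mem_cambrian; set z := (_ `|` _)%O.
  (* Splitting the left-hand join in [z <= z] shows that z contains each of the four tables. *)
  have : (z <= z)%O by [].
  rewrite {1}/z !leUx -!andbA.
  case/and4P => /subsetP x1z /subsetP x2z /subsetP x3z.
  move=> /subsetP yz; apply/subsetP => q; rewrite in_set !mem_cat.
  by case/or4P => hq; [apply: x1z|apply: x2z|apply: x3z|apply: yz];
    rewrite in_set.
(* Meets are intersections, so one finite check over the pairs of s, the table of a hatted x, bounds
   a whole joinand of Q. *)
have le_cut (a b1 b2 b3 : cambrian U12) s (cs : cambrian_table 12 u12 s) :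
    all (fun p => [&& p \in table_yh1, p \in table_yh2 & p \in table_yh3]
      ==> (p \in table_cut)) s ->
    (a <= table_elt cs -> b1 <= table_elt cyh1 -> b2 <= table_elt cyh2 ->
     b3 <= table_elt cyh3 -> a `&` b1 `&` b2 `&` b3 <= table_elt ccut)%O.
  move=> /allP s_cut /subsetP as_ /subsetP b1y /subsetP b2y /subsetP b3y.
  apply/subsetP => p; rewrite !mem_cambrian_meet -!andbA.
  case/and4P => /as_ pa /b1y p1 /b2y p2 /b3y p3.
  move: pa p1 p2 p3; rewrite !in_set => /s_cut/implyP + p1 p2 p3; apply.
  by rewrite p1 p2.
have lhs_1_12 : (pt 1, pt 12) \in cambrian_val (identity_lhs x1 x2 x3 y1 y2 y3).
  rewrite !mem_cambrian_meet -andbA; apply/and3P; split.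
  - by apply: (in_join _ cy1 [:: pt 2; pt 3; pt 4; pt 8]); vm_compute.
  - by apply: (in_join _ cy2 [:: pt 5; pt 6; pt 7; pt 8]); vm_compute.
  - by apply: (in_join _ cy3 [:: pt 5; pt 9; pt 10; pt 11]); vm_compute.
have yh1 : (y2 `|` y3 `|` x1 `|` x2 `|` x3 <= table_elt cyh1)%O.
  by rewrite 4!leUx !table_elt_le //; vm_compute.
have yh2 : (y1 `|` y3 `|` x1 `|` x2 `|` x3 <= table_elt cyh2)%O.
  by rewrite 4!leUx !table_elt_le //; vm_compute.
have yh3 : (y1 `|` y2 `|` x1 `|` x2 `|` x3 <= table_elt cyh3)%O.
  by rewrite 4!leUx !table_elt_le //; vm_compute.
have rhs_cut : (identity_rhs x1 x2 x3 y1 y2 y3 <= table_elt ccut)%O.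
  rewrite /identity_rhs /= 2!leUx -andbA; apply/and3P; split.
  - apply: (le_cut _ _ _ _ _ cxh1 _ _ yh1 yh2 yh3); first by vm_compute.
    by rewrite 4!leUx !table_elt_le //; vm_compute.
  - apply: (le_cut _ _ _ _ _ cxh2 _ _ yh1 yh2 yh3); first by vm_compute.
    by rewrite 4!leUx !table_elt_le //; vm_compute.
  - apply: (le_cut _ _ _ _ _ cxh3 _ _ yh1 yh2 yh3); first by vm_compute.
    by rewrite 4!leUx !table_elt_le //; vm_compute.
apply/negP => lhs_rhs; have /subsetP := le_trans lhs_rhs rhs_cut.
by move=> /(_ _ lhs_1_12); rewrite in_set; vm_compute.
Qed.

Theorem theorem12p1 :
  let U : {set 'I_12} := [set i : 'I_12 | i.+1 \in [:: 5; 6; 9; 10; 11]] in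
  ~ satisfies_identity (cambrian U) /\
  hom_image_of_sublattice (doubled 3 3) (cambrian U).
Proof.
have [x1 [x2 [x3 [y1 [y2 [y3 fails]]]]]] := cambrian12_identity_failure.
split=> [sat|]; last exact: hom_image_of_identity_failure fails.
exact: negP fails (sat x1 x2 x3 y1 y2 y3).
Qed.
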